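(* Let $S$ be a non special numerical semigroup, and put $g=\operatorname{g}(S)$, $n=\operatorname{n}(S)$. Then there exists $r\in\mathbb{N}$ such that $\mathcal{A}^{r}(S)$ is defined (i.e. $S,\mathcal{A}(S),\ldots,\mathcal{A}^{r-1}(S)$ are all non special) and $$\mathcal{A}^{r}(S)=\{0\}\cup\{g,g+1,\ldots,g+n-2\}\cup\{x\in\mathbb{N}\mid x\ge g+n\};$$ that is, $\mathcal{A}^r(S)$ is an almost-ordinary numerical semigroup.
   Context: $\mathbb{N}=\{0,1,2,\ldots\}$. A numerical semigroup is a submonoid $S$ of $(\mathbb{N},+)$ with $\mathbb{N}\setminus S$ finite. $\operatorname{H}(S)=\mathbb{N}\setminus S$; $\operatorname{g}(S)=|\operatorname{H}(S)|$; $\operatorname{F}(S)=\max\operatorname{H}(S)$; $\operatorname{m}(S)=\min(S\setminus\{0\})$; $\operatorname{n}(S)=|\{s\in S\mid s<\operatorname{F}(S)\}|$. Special gaps: $\operatorname{SG}(S)=\{h\in\operatorname{H}(S)\mid 2h\in S \text{ and } h+s\in S \text{ for all } s\in S\setminus\{0\}\}$. $S$ is special if there is no $h\in\operatorname{SG}(S)\setminus\{\operatorname{F}(S)\}$ with $h>\operatorname{m}(S)$. For non special $S$, with $h=\max(\operatorname{SG}(S)\setminus\{\operatorname{F}(S)\})$, $\mathcal{A}(S)=(S\cup\{h\})\setminus\{\operatorname{m}(S)\}$; $\mathcal{A}^r$ denotes the $r$-fold iterate. A numerical semigroup is almost-ordinary if it equals $\{0\}\cup\{g,\ldots,g+n-2\}\cup\{x\in\mathbb{N}\mid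 x\ge g+n\}$ for some integers $g>2$, $n\in[2,g]$. *)

(* Defs.v *)
From mathcomp Require Import all_boot all_order.
From mathcomp Require Import finmap.
From mathcomp Require Import boolp classical_sets functions cardinality.

Set Implicit Arguments.
Unset Strict Implicit.
Unset Printing Implicit Defensive.

Local Open Scope classical_set_scope.

Definition numerical_semigroup (S : set nat) : Prop :=
  [/\ S 0, (forall x y, S x -> S y -> S (x + y)) & finite_set (~` S)].

(* Total versions of max and min, with junk value 0 when there is no largest
   (resp. smallest) element. *)
Definition set_max (A : set nat) : nat := xget 0 (A `&` ubound A).
Definition set_min (A : set nat) : nat := xget 0 (A `&` lbound A).

Definition gaps (S : set nat) : set nat := ~` S.

Definition genus (S : set nat) : nat := #|` fset_set (gaps S) |.

(* The junk value [frobenius setT = 0] is harmless: [setT] has no gaps, hence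
   is special, and [nleft setT = 0]. *)
Definition frobenius (S : set nat) : nat := set_max (gaps S).

Definition multiplicity (S : set nat) : nat := set_min (S `\ 0).

Definition nleft (S : set nat) : nat :=
  #|` fset_set [set s | S s /\ s < frobenius S] |.

Definition special_gaps (S : set nat) : set nat :=
  [set h | [/\ gaps S h, S (2 * h) & forall s, (S `\ 0) s -> S (h + s)]].

Definition special (S : set nat) : Prop :=
  ~ exists h, (special_gaps S `\ frobenius S) h /\ multiplicity S < h.

Definition non_special (S : set nat) : Prop :=
  numerical_semigroup S /\ ~ special S.

(* Only meaningful when [non_special S]. *)
Definition calA (S : set nat) : set nat :=
  (S `|` [set set_max (special_gaps S `\ frobenius S)]) `\ multiplicity S.

Definition calA_iter_defined (r : nat) (S : set nat) : Prop :=
  forall i, i < r -> non_special (iter i calA S).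

(* Used with [2 <= n], so that the subtraction is not truncated. *)
Definition almost_ordinary_set (g n : nat) : set nat :=
  [set 0] `|` [set x | g <= x <= g + n - 2] `|` [set x | g + n <= x].

Definition almost_ordinary (S : set nat) : Prop :=
  numerical_semigroup S /\
  exists g n, [/\ 2 < g, 2 <= n <= g & S = almost_ordinary_set g n].

(* Main.v *)
(** Each step of the iteration preserves the genus, the Frobenius number [F] and
    [nleft], and strictly increases the multiplicity, which stays below [F]; so
    it reaches a special [T = calA S] with [S] non special. The element [m']
    removed from [S] is a special gap of [T], so [m'] and [F - m'] are both gaps
    of [T]. The largest [x] such that [x] and [F - x] are gaps and [F < 2 x] is
    then a special gap, hence [F < 2 m(T)] because [T] is special. Consequently
    the largest gap other than [F] is special if it exceeds [m(T)], and so the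
    gaps of [T] are [1, ..., m(T) - 1] and [F]. *)
Require Import Defs.
From mathcomp Require Import all_boot all_order.
From mathcomp Require Import finmap.
From mathcomp Require Import boolp classical_sets functions cardinality.
From mathcomp Require Import zify.

Set Implicit Arguments.
Unset Strict Implicit.
Unset Printing Implicit Defensive.

Local Open Scope classical_set_scope.

(** * Maxima, minima and cardinalities of sets of naturals *)

Lemma set_maxP (A : set nat) (N x : nat) :
  ubound A N -> A x -> A (set_max A) /\ forall y, A y -> y <= set_max A.
Proof.
move=> AN Ax.
have exA : exists i, `[< A i >] by exists x; apply/asboolP.
have ubA i : `[< A i >] -> i <= N by move=> /asboolP /AN; rewrite leEnat.
have [M /asboolP AM Mmax] := ex_maxnP exA ubA.
rewrite /set_max; case: xgetP => [y _ [Ay yub]|/(_ M)[]].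
  by split=> // z /yub; rewrite leEnat.
by split=> // z /asboolP /Mmax; rewrite leEnat.
Qed.

Lemma set_minP (A : set nat) (x : nat) :
  A x -> A (set_min A) /\ forall y, A y -> set_min A <= y.
Proof.
move=> Ax.
have exA : exists i, `[< A i >] by exists x; apply/asboolP.
have [M /asboolP AM Mmin] := ex_minnP exA.
rewrite /set_min; case: xgetP => [y _ [Ay ylb]|/(_ M)[]].
  by split=> // z /ylb; rewrite leEnat.
by split=> // z /asboolP /Mmin; rewrite leEnat.
Qed.

Lemma set_max_eq (A : set nat) (M : nat) :
  A M -> (forall y, A y -> y <= M) -> set_max A = M.
Proof.
move=> AM Mub.
have [Am maxA] : A (set_max A) /\ forall y, A y -> y <= set_max A.
  by apply: (@set_maxP A M M) => // y /Mub; rewrite leEnat.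
by apply/eqP; rewrite eqn_leq Mub ?maxA.
Qed.

Lemma finite_set_nat_ubound (A : set nat) : finite_set A -> exists N, ubound A N.
Proof.
move=> finA; exists (\max_(i <- fset_set A) i) => x Ax.
by rewrite leEnat; apply: leq_bigmax_seq => //; rewrite in_fset_set ?inE.
Qed.

Lemma ubound_finite_set (A : set nat) (N : nat) :
  (forall x, A x -> x <= N) -> finite_set A.
Proof. by move=> AN; apply: (sub_finite_set _ (finite_II N.+1)) => x /AN. Qed.

Lemma card_fset_set_seq (A : set nat) (s : seq nat) :
  uniq s -> (forall x, A x <-> x \in s) -> #|` fset_set A| = size s.
Proof.
move=> us As.
have -> : A = [set` [fset x in s]%fset].
  by apply/seteqP; split=> x /=; rewrite in_fset /= As.
by rewrite set_fsetK card_fseq undup_id.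
Qed.

Lemma card_fset_set_swap (A : set nat) (a b : nat) :
  finite_set A -> A a -> ~ A b ->
  #|` fset_set ((A `\ a) `|` [set b])| = #|` fset_set A|.
Proof.
move=> finA Aa nAb.
have finD : finite_set (A `\ a) by apply: finite_setD.
rewrite fset_setU // fset_setD // !fset_set1 fsetUC cardfsU1 !inE.
rewrite in_fset_set // (memNset nAb) andbF /=.
by rewrite [RHS](cardfsD1 a) in_fset_set // mem_set.
Qed.

(** * Gaps and special gaps of a numerical semigroup *)

Section NumericalSemigroup.
Variable S : set nat.
Hypothesis nsS : numerical_semigroup S.

Lemma frobeniusP (x : nat) :
  ~ S x -> ~ S (frobenius S) /\ forall y, ~ S y -> y <= frobenius S.
Proof.
case: nsS => _ _ /finite_set_nat_ubound [N ubN] nSx.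
exact: set_maxP ubN nSx.
Qed.

Lemma gt_frobenius (x : nat) : frobenius S < x -> S x.
Proof.
move=> Fx; apply: contrapT => nSx.
by have [_ /(_ _ nSx)] := frobeniusP nSx; rewrite leqNgt Fx.
Qed.

Lemma multiplicityP :
  [/\ S (multiplicity S), 0 < multiplicity S
    & forall s, S s -> 0 < s -> multiplicity S <= s].
Proof.
(* This nonzero element shows that the minimum is never the default value, even for [setT], where
   [frobenius] is 0. *)
have : (S `\ 0) (frobenius S).+1 by split=> //=; apply: gt_frobenius.
case/set_minP => -[Sm /eqP m0] mmin; split=> //; first by rewrite lt0n.
by move=> s Ss s0; apply: mmin; split=> //= s0'; rewrite s0' in s0.
Qed.

Lemma lt_multiplicity (x : nat) : 0 < x -> x < multiplicity S -> ~ S x.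
Proof.
case: multiplicityP => _ _ mmin x0 xm Sx.
by have := mmin x Sx x0; rewrite leqNgt xm.
Qed.

(* Otherwise [F = h + (F - h)] would lie in [S]. *)
Lemma special_gap_compl (h : nat) :
  special_gaps S h -> h < frobenius S -> ~ S (frobenius S - h).
Proof.
move=> [nSh _ hS] hF SFh; have [nSF _] := frobeniusP nSh.
apply: nSF; rewrite -(subnKC (ltnW hF)); apply: hS; split=> //=; lia.
Qed.

(** Maximality does the work: take the largest [h] in the set [D] of candidates. If [h + s] were a
    gap, its complement would be a gap too, since adding [s] to it gives [frobenius S - h]; then
    [h + s] would be a larger member of [D]. The bound on [2 * h] puts it beyond the Frobenius
    number. *)
Lemma special_gap_of_compl (x : nat) :
  ~ S x -> ~ S (frobenius S - x) -> frobenius S < 2 * x ->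
  exists h, [/\ special_gaps S h, h < frobenius S & x <= h].
Proof.
move=> nSx nSFx Fx; case: nsS => S0 SD _.
have [nSF ubF] := frobeniusP nSx.
pose D := [set y | [/\ ~ S y, ~ S (frobenius S - y) & frobenius S < 2 * y]].
have ubD : ubound D (frobenius S) by move=> y [/ubF yF _ _]; rewrite leEnat.
have [[nSh nSFh Fh] hmax] := set_maxP ubD (And3 nSx nSFx Fx : D x).
set h := set_max D in nSh nSFh Fh hmax.
have hF : h < frobenius S.
  by rewrite ltn_neqAle ubF // andbT; apply/eqP => hF; apply: nSFh; rewrite hF subnn.
exists h; split=> //; last exact: hmax.
split=> //; first exact: gt_frobenius.
move=> s [Ss /eqP s0]; apply: contrapT => nShs.
(* Without this bound the subtraction [frobenius S - (h + s)] could be truncated. *)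
have hsF := ubF _ nShs.
suff /hmax : D (h + s) by lia.
split=> //; last by lia.
move=> SFhs; apply: nSFh; have -> : frobenius S - h = frobenius S - (h + s) + s by lia.
exact: SD.
Qed.

(** Any two numbers that are at least the multiplicity add up to more than the Frobenius number,
    hence to an element. The largest gap other than [frobenius S] would therefore be special if it
    reached the multiplicity: adding a nonzero element gives no gap. *)
Lemma special_gaps_lt_double (h : nat) :
  special S -> frobenius S < 2 * multiplicity S ->
  ~ S h -> h != frobenius S -> h < multiplicity S.
Proof.
move=> spS F2m nSh hF; rewrite ltnNge; apply/negP => mh.
have [Sm m0 mmin] := multiplicityP.
pose D := [set y | [/\ ~ S y, y != frobenius S & multiplicity S <= y]].
have ubD : ubound D (frobenius S).
  by move=> y [nSy _ _]; rewrite leEnat; apply: (frobeniusP nSy).2.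
have [[nSk kF mk] _] := set_maxP ubD (And3 nSh hF mh : D h).
apply: spS; exists (set_max D); split; last first.
  by rewrite ltn_neqAle mk andbT; apply/eqP => mE; apply: nSk; rewrite -mE.
split; last exact/eqP.
split=> //; first by apply: gt_frobenius; lia.
move=> s [Ss /eqP s0]; apply: gt_frobenius.
have := mmin s Ss; lia.
Qed.

End NumericalSemigroup.

(** * One step of [calA] on a non special semigroup *)

Section Step.
Variable S : set nat.
Hypothesis nspS : non_special S.

Let nsS : numerical_semigroup S := nspS.1.
Let h := set_max (special_gaps S `\ frobenius S).

(** The maximum defining [h] ranges over all special gaps other than [frobenius S]; non speciality
    provides one above the multiplicity, so the maximum lies above it as well. *)
Lemma calA_added :
  [/\ special_gaps S h, multiplicity S < h & h < frobenius S].
Proof.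
have [x [[SGx xF] mx]] : exists x,
    (special_gaps S `\ frobenius S) x /\ multiplicity S < x.
  exact: contrapT nspS.2.
have ubSG : ubound (special_gaps S `\ frobenius S) (frobenius S).
  by move=> y [[nSy _ _] _]; rewrite leEnat; apply: (frobeniusP nsS nSy).2.
have [[SGh /eqP hF] hmax] := set_maxP ubSG (conj SGx xF).
have xh : x <= h by apply: hmax.
split=> //; first exact: leq_trans mx xh.
rewrite ltn_neqAle hF; case: SGh => nSh _ _; exact: (frobeniusP nsS nSh).2.
Qed.

Lemma calAP (x : nat) :
  calA S x <-> (S x \/ x = h) /\ x <> multiplicity S.
Proof. by []. Qed.

Lemma multiplicity_frobenius : multiplicity S < frobenius S.
Proof. by have [_ mh hF] := calA_added; apply: ltn_trans hF. Qed.

Lemma frobenius_gap : ~ S (frobenius S).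
Proof. by have [[nSh _ _] _ _] := calA_added; case: (frobeniusP nsS nSh). Qed.

(** Sums involving [h] stay in [S] because [h] is a special gap. A sum of two nonzero elements
    cannot be the removed [multiplicity S], since each summand already is at least that large. *)
Lemma numerical_semigroup_calA : numerical_semigroup (calA S).
Proof.
have [[nSh S2h hS] mh hF] := calA_added.
have [Sm m0 mmin] := multiplicityP nsS.
case: nsS => S0 SD finS.
have hS' x : S x -> x <> 0 -> S (h + x) by move=> Sx x0; apply: hS.
split.
- by apply/calAP; split; [left|lia].
- move=> x y /calAP[Tx xm] /calAP[Ty ym]; apply/calAP.
  have [->|/eqP x0] := eqVneq x 0; first by [].
  have [->|/eqP y0] := eqVneq y 0; first by rewrite addn0.
  split.
    left; case: Tx Ty => [Sx|->] [Sy|->].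
    + exact: SD.
    + by rewrite addnC; apply: hS'.
    + exact: hS'.
    + by rewrite addnn -mul2n.
  have : multiplicity S <= x by case: Tx => [Sx|->]; [apply: mmin => //|]; lia.
  lia.
- apply: (ubound_finite_set (N := frobenius S)) => x nTx.
  rewrite leqNgt; apply/negP => Fx; apply: nTx; apply/calAP; split.
    left; exact: gt_frobenius.
  lia.
Qed.

Lemma frobenius_calA : frobenius (calA S) = frobenius S.
Proof.
have [_ mh hF] := calA_added.
apply: set_max_eq => [/calAP[[/frobenius_gap//|FE] _]|x nTx]; first by lia.
rewrite leqNgt; apply/negP => Fx; apply: nTx; apply/calAP; split; last by lia.
by left; apply: gt_frobenius.
Qed.

Lemma multiplicity_calA : multiplicity S < multiplicity (calA S).
Proof.
have [_ _ mmin] := multiplicityP nsS.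
have [/calAP[Tm mm] m0 _] := multiplicityP numerical_semigroup_calA.
have [_ mh _] := calA_added.
case: Tm => [Sm|->//]; have := mmin _ Sm m0; lia.
Qed.

(** The new element [h] is nonzero and lies below [frobenius S]. *)
Lemma multiplicity_calA_frobenius : multiplicity (calA S) < frobenius S.
Proof.
have [_ mh hF] := calA_added.
have [_ _ /(_ h)] := multiplicityP numerical_semigroup_calA.
have Th : calA S h by apply/calAP; split; [right|lia].
by move=> /(_ Th); lia.
Qed.

Lemma genus_calA : genus (calA S) = genus S.
Proof.
have [[nSh _ _] mh hF] := calA_added; have [Sm _ _] := multiplicityP nsS.
rewrite /genus -(@card_fset_set_swap (gaps S) h (multiplicity S)) //.
- congr #|` fset_set _|; apply/seteqP; split=> x /=.
    move=> nTx; have [->|/eqP xm] := eqVneq x (multiplicity S); first by right.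
    left; split; first by move=> Sx; apply: nTx; apply/calAP; split; [left|].
    by move=> xh; apply: nTx; apply/calAP; split; [right|].
  by case=> [[nSx xh]|->] /calAP[[Sx|xE] xm].
- by case: nsS.
Qed.

(** The exchanged elements [multiplicity S] and [h] both lie below the Frobenius number, which does
    not change. *)
Lemma nleft_calA : nleft (calA S) = nleft S.
Proof.
have [[nSh _ _] mh hF] := calA_added; have [Sm _ _] := multiplicityP nsS.
rewrite /nleft frobenius_calA.
rewrite -(@card_fset_set_swap [set s | S s /\ s < frobenius S] (multiplicity S) h).
- congr #|` fset_set _|; apply/seteqP; split=> x /=.
    by move=> [/calAP[[Sx|->] xm] xF]; [left|right].
  move=> [[[Sx xF] xm]|->]; split=> //; apply/calAP; split; [by left|by []|by right|].
  by lia.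
- by apply: (ubound_finite_set (N := frobenius S)) => x [_ /ltnW].
- split=> //; exact: multiplicity_frobenius.
- by case.
Qed.

(** * The case where [calA S] is special *)

Lemma multiplicity_special_gap_calA : special_gaps (calA S) (multiplicity S).
Proof.
have [[nSh _ hS] mh hF] := calA_added; have [Sm m0 _] := multiplicityP nsS.
case: nsS => _ SD _; split; first by move=> /calAP[].
- apply/calAP; split; last by lia.
  by left; rewrite mul2n -addnn; apply: SD.
- move=> s [/calAP[Ts sm] /= s0]; apply/calAP; split; last by lia.
  left; case: Ts => [Ss|->]; first exact: SD.
  by rewrite addnC; apply: hS; split=> //=; lia.
Qed.

Lemma frobenius_lt_double_multiplicity_calA :
  special (calA S) -> frobenius S < 2 * multiplicity (calA S).
Proof.
move=> spT; have nsT := numerical_semigroup_calA.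
have SGm := multiplicity_special_gap_calA; have mF := multiplicity_frobenius.
have mT := multiplicity_calA.
have [F2m|m2F] := ltnP (frobenius S) (2 * multiplicity S); first by lia.
have FTgap : ~ calA S (frobenius S).
  by rewrite -frobenius_calA; case: SGm => nTm _ _; case: (frobeniusP nsT nTm).
have nF2m : 2 * multiplicity S <> frobenius S.
  by move=> FE; apply: FTgap; rewrite -FE; case: SGm.
have nTFm := special_gap_compl nsT SGm.
rewrite frobenius_calA in nTFm.
(* The complement of this witness is [multiplicity S], and [2 * multiplicity S < frobenius S] in
   this branch. Speciality bounds [k] by the new multiplicity, so [frobenius S] is at most the sum
   of the old and new multiplicities, less than twice the new one. *)
have [||//|k [SGk kF mk]] := @special_gap_of_compl _ nsT (frobenius S - multiplicity S).
- exact: nTFm.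
- rewrite frobenius_calA subKn; last exact: ltnW.
  by case: SGm.
- by rewrite frobenius_calA; lia.
rewrite frobenius_calA in kF.
suff : k <= multiplicity (calA S) by lia.
rewrite leqNgt; apply/negP => mTk; apply: spT; exists k; split=> //.
by split=> //=; rewrite frobenius_calA; lia.
Qed.

Lemma calA_special_almost_ordinary :
  special (calA S) ->
  calA S = almost_ordinary_set (genus S) (nleft S) /\ almost_ordinary (calA S).
Proof.
move=> spT; have nsT := numerical_semigroup_calA.
have F2m := frobenius_lt_double_multiplicity_calA spT.
have mTF := multiplicity_calA_frobenius; have mT := multiplicity_calA.
(* As the multiplicity then grows strictly, this yields the condition [2 < g]. *)
have m_gt1 : 1 < multiplicity S.
  have [Sm m0 mmin] := multiplicityP nsS; rewrite ltn_neqAle m0 andbT.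
  apply/eqP => m1; apply: frobenius_gap.
  suff Sall k : S k by [].
  case: nsS => S0 SD _; elim: k => // k IHk.
  by rewrite -addn1; apply: SD => //; rewrite m1.
have gapsT x : ~ calA S x <-> (0 < x < multiplicity (calA S)) \/ x = frobenius S.
  split.
    move=> nTx; have [xF|xF] := eqVneq x (frobenius S); [by right|left].
    apply/andP; split.
      by rewrite lt0n; apply/eqP => x0; apply: nTx; rewrite x0; case: nsT.
    by apply: (special_gaps_lt_double nsT); rewrite ?frobenius_calA.
  move=> [/andP[x0 xm]|->]; first exact: lt_multiplicity nsT _ x0 xm.
  case: multiplicity_special_gap_calA => nTm _ _.
  by rewrite -frobenius_calA; case: (frobeniusP nsT nTm).
have memT x : calA S x <-> ~ ((0 < x < multiplicity (calA S)) \/ x = frobenius S).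
  by rewrite -gapsT notK.
have gE : genus S = multiplicity (calA S).
  rewrite -genus_calA /genus.
  rewrite (@card_fset_set_seq _ (frobenius S :: iota 1 (multiplicity (calA S)).-1)).
  - by rewrite /= size_iota; lia.
  - by rewrite /= iota_uniq mem_iota andbT; lia.
  - move=> x; rewrite inE mem_iota; apply: (iff_trans (gapsT x)).
    split; first by case=> [|->]; rewrite ?eqxx //; lia.
    by case/orP => [/eqP|]; [right|left; lia].
(* The extra one counts the element 0. With [gE], this makes [g + n - 2] equal to
   [frobenius S - 1]. *)
have nE : nleft S = (frobenius S - multiplicity (calA S)).+1.
  rewrite -nleft_calA /nleft frobenius_calA.
  rewrite (@card_fset_set_seq _
    (0 :: iota (multiplicity (calA S)) (frobenius S - multiplicity (calA S)))).
  - by rewrite /= size_iota.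
  - by rewrite /= iota_uniq mem_iota andbT; lia.
  - move=> x; rewrite inE mem_iota /=; rewrite memT; split; lia.
have TE : calA S = almost_ordinary_set (genus S) (nleft S).
  apply/seteqP; split=> x; rewrite memT /almost_ordinary_set /= gE nE.
    move=> H; suff : [|| x == 0, multiplicity (calA S) <= x <= frobenius S - 1 |
        frobenius S < x] by case/or3P => [/eqP|?|?]; [left; left|left; right|right]; lia.
    lia.
  by case=> [[->|]|]; lia.
(* Here [n <= g] amounts to [F2m], and [2 <= n] to [mTF]. *)
split=> //; split=> //; exists (genus S), (nleft S); split=> //; rewrite gE ?nE; lia.
Qed.

End Step.

Theorem theorem4p5 (S : set nat) (hS : non_special S) :
  exists r : nat,
    [/\ calA_iter_defined r S,
        iter r calA S = almost_ordinary_set (genus S) (nleft S)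
      & almost_ordinary (iter r calA S)].
Proof.
(* This difference drops at each step: the Frobenius number is fixed, the multiplicity grows, and it
   starts below the Frobenius number, so truncation does no harm. *)
have [k] := ubnP (frobenius S - multiplicity S).
elim: k S hS => // k IHk S hS lek.
have [spT|nspT] := pselect (special (calA S)).
  have [TE aoT] := calA_special_almost_ordinary hS spT.
  by exists 1; split=> //; case.
have nT : non_special (calA S) by split=> //; apply: numerical_semigroup_calA.
have [|r [defr TE aoT]] := IHk _ nT.
  have := multiplicity_frobenius hS; have := multiplicity_calA hS.
  by rewrite frobenius_calA //; lia.
exists r.+1; rewrite iterSr -(genus_calA hS) -(nleft_calA hS); split=> //.
by case=> // i ir; rewrite iterSr; apply: defr.
Qed.
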